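(* Let $H=(V,E)$ be a connected finite hypergraph with vertex measure $\mu$ and hyperedge weight $\omega$. For any functions $\phi,\psi:V\to\mathbb{R}$, $$\int_V\nabla\phi\nabla\psi\,d\mu=\int_V(-\Delta\phi)\psi\,d\mu.$$
   Context: A (finite, undirected) hypergraph $H=(V,E)$ consists of a finite vertex set $V$ and a set $E$ of hyperedges, each hyperedge $e\in E$ being a subset of $V$ with cardinality $\delta_e:=|e|$ satisfying $2\le\delta_e\le|V|$. $H$ is connected if for any two different vertices $v,v'$ there is a sequence of hyperedges $e_1,\dots,e_l\in E$ with $v\in e_1$, $v'\in e_l$ and $e_n\cap e_{n+1}\ne\emptyset$ for $1\le n\le l-1$. The measure is a function $\mu:V\to(0,\infty)$ and the weight is a function $\omega:E\to(0,\infty)$, written $\omega_e=\omega(e)$. $\int_V g\,d\mu=\sum_{v\in V}\mu(v)g(v)$. The gradient $\nabla\phi(v)$ at a vertex $v$ is the vector indexed by the hyperedges $e\ni v$ with entries $\sqrt{\frac{\omega_e}{\mu(v)\delta_e(\delta_e-1)}}\sum_{u\in e}(\phi(u)-\phi(v))$, and $\nabla\phi\nabla\psi$ at $v$ is the Euclidean dot product $$\nabla\phi(v)\nabla\psi(v)=\sum_{e\in E:\,v\in e}\frac{\omega_e}{\mu(v)\delta_e(\delta_e-1)}\Big[\sum_{u\in e}(\phi(u)-\phi(v))\Big]\Big[\sum_{u\in e}(\psi(u)-\psi(v))\Big].$$ The Laplace operator (divergence of the hypergraph gradient) is given explicitly by $$\Delta\phi(v)=\frac{1}{\mu(v)}\sum_{e\in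 E:\,v\in e}\frac{\omega_e}{\delta_e-1}\sum_{u\in e:\,u\ne v}(\phi(u)-\phi(v)).$$ *)

(* Defs.v *)
From HB Require Import structures.
From mathcomp Require Import all_boot all_order all_algebra.
From mathcomp Require Import reals.

Set Implicit Arguments.
Unset Strict Implicit.
Unset Printing Implicit Defensive.

Import Order.TTheory GRing.Theory Num.Theory.
Local Open Scope ring_scope.

(* The upper bound [#|e| <= #|V|] on the size of a hyperedge is [max_card]. *)
Record hypergraph (V : finType) := Hypergraph {
  hyperedges : {set {set V}};
  hyperedge_card : forall e, e \in hyperedges -> (2 <= #|e|)%N
}.

(* The nonempty sequence of hyperedges e_1, ..., e_l is [e :: p]. *)
Definition connected_hypergraph (V : finType) (H : hypergraph V) : Prop :=
  forall v v' : V, v != v' ->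
  exists (e : {set V}) (p : seq {set V}),
    [/\ {subset e :: p <= hyperedges H},
        path (fun e1 e2 : {set V} => e1 :&: e2 != set0) e p,
        v \in e & v' \in last e p].

Section Operators.
Variables (R : realType) (V : finType) (H : hypergraph V).

(* Weights are total functions on [{set V}]; only their values on
   [hyperedges H] are ever used. *)
Variables (mu : V -> R) (omega : {set V} -> R).

Definition vertex_integral (g : V -> R) : R := \sum_(v : V) mu v * g v.

(* The gradient at v is a vector indexed by the hyperedges containing v: the
   entries at other sets e are junk, and [gradient_dot] discards them. *)
Definition gradient (phi : V -> R) (v : V) (e : {set V}) : R :=
  Num.sqrt (omega e / (mu v * #|e|%:R * (#|e|%:R - 1)))
  * \sum_(u in e) (phi u - phi v).

Definition gradient_dot (phi psi : V -> R) (v : V) : R :=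
  \sum_(e in hyperedges H | v \in e) gradient phi v e * gradient psi v e.

Definition laplacian (phi : V -> R) (v : V) : R :=
  (mu v)^-1 * \sum_(e in hyperedges H | v \in e)
    omega e / (#|e|%:R - 1) * \sum_(u in e | u != v) (phi u - phi v).

End Operators.

(* Main.v *)
Require Import Defs.
From HB Require Import structures.
From mathcomp Require Import all_boot all_order all_algebra.
From mathcomp Require Import reals ring.

Set Implicit Arguments.
Unset Strict Implicit.
Unset Printing Implicit Defensive.

Import Order.TTheory GRing.Theory Num.Theory.
Local Open Scope ring_scope.

(** Both sides are double sums over incident pairs (vertex, hyperedge), and
    they already agree hyperedge by hyperedge.  Fix [e] of size [d] and let
    [D phi v] be the sum over [u] in [e] of [phi u - phi v].  The measure
    cancels, so [e] contributes
      [omega e / (d (d - 1)) * \sum_(v in e) D phi v * D psi v]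
    on the left and
      [- omega e / (d - 1) * \sum_(v in e) D phi v * psi v]
    on the right.  The values [D phi v] sum to zero over [e], by antisymmetry
    of [phi u - phi v]; since [D psi v] is a constant minus [d * psi v], the
    constant drops out ([sum_edge_diffM]), and the remaining factor [d] turns
    one coefficient into the other. *)

Lemma exchange_incidence (M : nmodType) (V : finType) (E : {set {set V}})
    (F : V -> {set V} -> M) :
  \sum_v \sum_(e in E | v \in e) F v e = \sum_(e in E) \sum_(v in e) F v e.
Proof.
rewrite (exchange_big_dep (mem E)) => [|v e _ /andP[]//].
by apply: eq_bigr => e /= eE; apply: eq_bigl => v; rewrite eE.
Qed.

Section EdgeDifferences.
Variables (R : comNzRingType) (V : finType).
Implicit Types (e : {set V}) (f g : V -> R).

Lemma sum_edge_diffE e f (c : R) :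
  \sum_(u in e) (f u - c) = \sum_(u in e) f u - #|e|%:R * c.
Proof. by rewrite sumrB sumr_const mulr_natl. Qed.

(** Exchanging [u] and [v] changes the sign of the summand. *)
Lemma sum_edge_diff_eq0 e f : \sum_(v in e) \sum_(u in e) (f u - f v) = 0.
Proof.
under eq_bigr do rewrite sumrB.
by rewrite sumrB exchange_big subrr.
Qed.

(** Summation by parts inside one hyperedge: in the second factor only
    [- #|e|%:R * g v] depends on [v], and the rest is multiplied by a sum that
    vanishes. *)
Lemma sum_edge_diffM e f g :
  \sum_(v in e) (\sum_(u in e) (f u - f v)) * (\sum_(u in e) (g u - g v)) =
  - #|e|%:R * \sum_(v in e) (\sum_(u in e) (f u - f v)) * g v.
Proof.
under eq_bigr => v _ do rewrite (sum_edge_diffE e g) mulrBr.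
rewrite sumrB -mulr_suml sum_edge_diff_eq0 mul0r sub0r mulNr mulr_sumr.
by congr (- _); apply: eq_bigr => v _; rewrite mulrCA.
Qed.

End EdgeDifferences.

Section WeightedOperators.
Variables (R : realType) (V : finType) (H : hypergraph V).
Variables (mu : V -> R) (omega : {set V} -> R).
Hypothesis mu_gt0 : forall v : V, 0 < mu v.
Hypothesis omega_gt0 : forall e : {set V}, e \in hyperedges H -> 0 < omega e.

Lemma hyperedge_card_gt0 e : e \in hyperedges H -> 0 < #|e|%:R :> R.
Proof. by move=> /hyperedge_card /ltnW; rewrite ltr0n. Qed.

Lemma hyperedge_card_pred_gt0 e :
  e \in hyperedges H -> 0 < #|e|%:R - 1 :> R.
Proof. by move=> /hyperedge_card; rewrite subr_gt0 ltr1n. Qed.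

(** Positivity of the data makes the radicand nonnegative, so the two square
    roots multiply to the radicand, whose [mu v] the measure then cancels. *)
Lemma mu_gradientM f g v e : e \in hyperedges H ->
  mu v * (gradient mu omega f v e * gradient mu omega g v e) =
  omega e / (#|e|%:R * (#|e|%:R - 1)) *
    ((\sum_(u in e) (f u - f v)) * (\sum_(u in e) (g u - g v))).
Proof.
move=> eH; have d_gt0 := hyperedge_card_gt0 eH.
have d1_gt0 := hyperedge_card_pred_gt0 eH.
rewrite /gradient mulrACA -expr2 sqr_sqrtr; last first.
  by rewrite divr_ge0 ?mulr_ge0 // ltW // omega_gt0.
by field; rewrite !gt_eqF.
Qed.

(** The term [u = v] omitted by the Laplacian is zero, so the inner sum can
    run over the whole hyperedge, as in the gradient. *)
Lemma mu_laplacianM f g v :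
  mu v * (- laplacian H mu omega f v * g v) =
  \sum_(e in hyperedges H | v \in e)
    - (omega e / (#|e|%:R - 1)) * ((\sum_(u in e) (f u - f v)) * g v).
Proof.
rewrite /laplacian mulNr mulrN !mulrA divff ?gt_eqF // mul1r mulr_suml -sumrN.
apply: eq_bigr => e /andP[_ ve].
by rewrite [in RHS](bigD1 v) //= subrr add0r mulNr mulrA.
Qed.

End WeightedOperators.

Theorem lemma2p4 (R : realType) (V : finType) (H : hypergraph V)
    (mu : V -> R) (omega : {set V} -> R)
    (H_connected : connected_hypergraph H)
    (mu_gt0 : forall v : V, 0 < mu v)
    (omega_gt0 : forall e : {set V}, e \in hyperedges H -> 0 < omega e)
    (phi psi : V -> R) :
  vertex_integral mu (fun v => gradient_dot H mu omega phi psi v) =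
  vertex_integral mu (fun v => - laplacian H mu omega phi v * psi v).
Proof.
rewrite /vertex_integral /gradient_dot.
under eq_bigr do rewrite mulr_sumr.
under [RHS]eq_bigr do rewrite (mu_laplacianM _ _ mu_gt0).
rewrite !exchange_incidence; apply: eq_bigr => e eH.
under eq_bigr do rewrite (mu_gradientM mu_gt0 omega_gt0) //.
rewrite -!mulr_sumr sum_edge_diffM.
have d_gt0 := hyperedge_card_gt0 R eH.
have d1_gt0 := hyperedge_card_pred_gt0 R eH.
by field; rewrite !gt_eqF.
Qed.
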